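(* Let $S\in\mathbb{S}^n_+$ be fixed. The symmetrized Stein's loss $L(\Sigma,S)=\frac12\big(\langle S,\Sigma^{-1}\rangle+\langle \Sigma,S^{-1}\rangle\big)-n$ is a strictly convex function of $\Sigma\in\mathbb{S}^n_+$, and it is also a strictly convex function of $K=\Sigma^{-1}\in\mathbb{S}^n_+$ (that is, $K\mapsto L(K^{-1},S)$ is strictly convex on $\mathbb{S}^n_+$).
   Context: $\mathbb{S}^n$ is the space of real symmetric $n\times n$ matrices with inner product $\langle A,B\rangle=\mathrm{trace}(AB)$, and $\mathbb{S}^n_+\subseteq\mathbb{S}^n$ is the (convex) set of positive definite matrices. *)

(* Defs.v *)
From HB Require Import structures.
From mathcomp Require Import all_boot all_order all_algebra.
From mathcomp Require Import sesquilinear interval_inference.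
From mathcomp Require Import boolp classical_sets reals convex.

Set Implicit Arguments.
Unset Strict Implicit.
Unset Printing Implicit Defensive.

Import Order.TTheory GRing.Theory Num.Theory.

Local Open Scope classical_set_scope.
Local Open Scope ring_scope.
Local Open Scope convex_scope.

Definition posdefmx (R : realType) (n : nat) : set 'M[R]_n :=
  [set A | A \is symmetricmx /\
           forall u : 'rV[R]_n, u != 0 -> 0 < (u *m A *m u^T) 0 0].
Arguments posdefmx : clear implicits.

Definition mxinner (R : realType) (n : nat) (A B : 'M[R]_n) : R :=
  \tr (A *m B).

(* Strict counterpart of [convex_function]; unlike the latter, it also asks
   that the domain be convex. *)
Definition strictly_convex_function (R : realType) (E : lmodType R)
    (E' := convex_lmodType E) (D : set E') (f : E' -> R^o) : Prop :=
  convex_set D /\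
  forall t : {i01 R}, 0 < t%:num -> t%:num < 1 ->
    {in D &, forall x y : E', x != y ->
      (f (x <| t |> y) < f x <| t |> f y)%R}.

(* [invmx A] is the inverse of [A] when [A] is invertible, in particular when
   [A] is positive definite; for singular [A] it is [A] itself. *)
Definition symmetrized_stein_loss (R : realType) (n : nat)
    (Sigma S : 'M[R]_n) : R :=
  2^-1 * (mxinner S (invmx Sigma) + mxinner Sigma (invmx S)) - n%:R.

(* Main.v *)
Require Import Defs.
From HB Require Import structures.
From mathcomp Require Import all_boot all_order all_algebra.
From mathcomp Require Import sesquilinear interval_inference.
From mathcomp Require Import boolp classical_sets reals convex.

(** Both claims reduce to the strict convexity of Sigma |-> <S, Sigma^-1> for
    positive definite S. The other summand <Sigma, S^-1> is linear in Sigma,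
    and substituting K = Sigma^-1 only exchanges the two summands:
    L(K^-1, S) = L(K, S^-1), where S^-1 is again positive definite.

    For that strict convexity no calculus is needed: the gap in the convexity
    inequality is a sum of squares. Every invertible A and every matrix X
    satisfy
      (A^-1 - X) A (A^-1 - X) = A^-1 - 2 X + X A X.
    Let M = t A + (1 - t) B, take X = M^-1, and average this identity over A
    and B: the right-hand sides add up to t A^-1 + (1 - t) B^-1 - M^-1, since
    X M X = X ([conv_invmx_gap]). Paired with S, each term
    <S, D A D> with D = A^-1 - M^-1 is positive, because D is nonzero when
    A != B ([posdefmx_mxinner_gt0]); this last positivity comes from a Cholesky
    factorization A = L^T L ([posdefmx_cholesky]), which turns the inner product
    into the sum of the values of the quadratic form S at the rows of L D. *)

Set Implicit Arguments.
Unset Strict Implicit.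
Unset Printing Implicit Defensive.

Import Order.TTheory GRing.Theory Num.Theory.

Local Open Scope ring_scope.
Local Open Scope convex_scope.

Lemma symmetricmxP (F : fieldType) (n : nat) (A : 'M[F]_n) :
  reflect (A^T = A) (A \is symmetricmx).
Proof.
rewrite is_hermitianmxE expr0 scale1r map_mx_id // eq_sym.
exact: eqP.
Qed.

Section PositiveDefinite.
Variable R : realType.

Lemma posdefmx_tr (n : nat) (A : 'M[R]_n) : posdefmx R n A -> A^T = A.
Proof. by case=> /symmetricmxP. Qed.

Lemma posdefmx_unit (n : nat) (A : 'M[R]_n) : posdefmx R n A -> A \in unitmx.
Proof.
move=> [_ Apos]; rewrite -row_free_unit; apply: inj_row_free => v vA0.
apply/eqP; case: (eqVneq v 0) => // /Apos.
by rewrite vA0 mul0mx mxE ltxx.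
Qed.

(** The quadratic form of A^-1 at u is that of A at u A^-1. *)
Lemma posdefmx_inv (n : nat) (A : 'M[R]_n) :
  posdefmx R n A -> posdefmx R n (invmx A).
Proof.
move=> Apd; have [Au Atr] := (posdefmx_unit Apd, posdefmx_tr Apd).
split=> [|u u0]; first by apply/symmetricmxP; rewrite trmx_inv Atr.
have uA0 : u *m invmx A != 0.
  by apply: contraNneq u0 => uA0; rewrite -(mulmxKV Au u) uA0 mul0mx.
case: Apd => _ /(_ _ uA0).
by rewrite trmx_mul trmx_inv Atr mulmxKV // mulmxA.
Qed.

Lemma posdefmx_conv (n : nat) (t : R) (A B : 'M[R]_n) :
  0 <= t <= 1 -> posdefmx R n A -> posdefmx R n B ->
  posdefmx R n (t *: A + (1 - t) *: B).
Proof.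
move=> /andP[t0 t1] Apd Bpd; split=> [|u u0].
  by apply/symmetricmxP; rewrite linearD !linearZ /= !posdefmx_tr.
have [_ /(_ u u0) uA] := Apd; have [_ /(_ u u0) uB] := Bpd.
rewrite mulmxDr mulmxDl -!scalemxAr -!scalemxAl mxE.
rewrite [X in X + _]mxE [X in _ + X]mxE.
have [->|tn0] := eqVneq t 0; first by rewrite mul0r add0r subr0 mul1r.
have t_gt0 : 0 < t by rewrite lt0r tn0.
apply: ltr_pwDl; first exact: mulr_gt0.
by rewrite mulr_ge0 ?subr_ge0 // ltW.
Qed.

(** The quadratic form of the Schur complement at v is that of the whole matrix
    at the vector completing v by - a^-1 v b^T, the minimizer over the first
    coordinate. *)
Lemma posdefmx_schur (n : nat) (a : R) (b : 'rV[R]_n) (C : 'M[R]_n) :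
  0 < a -> posdefmx R (1 + n) (block_mx a%:M b b^T C) ->
  posdefmx R n (C - a^-1 *: (b^T *m b)).
Proof.
move=> a0 Apd; split=> [|v v0].
  have := posdefmx_tr Apd; rewrite tr_block_mx => /eq_block_mx[_ _ _ Ctr].
  by apply/symmetricmxP; rewrite linearB linearZ /= trmx_mul trmxK Ctr.
have u0 : row_mx (- (a^-1 *: (v *m b^T))) v != 0.
  apply: contraNneq v0 => u0.
  by have /eqP := congr1 rsubmx u0; rewrite row_mxKr linear0.
case: Apd => _ /(_ _ u0).
rewrite mul_row_block tr_row_mx mul_row_col mul_mx_scalar scalerN scalerA.
rewrite mulfV ?gt_eqF // scale1r addNr mul0mx add0r.
by rewrite mulmxBr mulNmx -scalemxAl -scalemxAr mulmxA [- _ + _]addrC.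
Qed.

(** Cholesky factorization by pivoting: the first row of L is that of A divided
    by the square root of the pivot A 0 0, which is the value of the form at the
    first basis vector; the rest of L factors the Schur complement. *)
Lemma posdefmx_cholesky (n : nat) (A : 'M[R]_n) :
  posdefmx R n A -> exists L : 'M[R]_n, A = L^T *m L.
Proof.
elim: n A => [|n IHn] A Apd; first by exists 0; apply/matrixP => -[].
move: A Apd; rewrite -[n.+1]/(1 + n)%N => A Apd.
pose a := A 0 0; pose b : 'rV_n := ursubmx A.
have e0 : (delta_mx 0 0 : 'rV[R]_(1 + n)) != 0.
  by apply/eqP => /rowP/(_ 0); rewrite !mxE eqxx => /eqP; rewrite oner_eq0.
have a0 : 0 < a.
  by case: Apd => _ /(_ _ e0); rewrite -rowE trmx_delta -colE !mxE.
have AE : A = block_mx a%:M b b^T (drsubmx A).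
  rewrite -{1}[A]submxK; congr block_mx.
    by rewrite [ulsubmx A]mx11_scalar !mxE !lshift0.
  by rewrite /b trmx_ursub posdefmx_tr.
have := Apd; rewrite AE => /(posdefmx_schur a0)/IHn[L LE].
pose s := Num.sqrt a; have s0 : s != 0 by rewrite gt_eqF ?sqrtr_gt0.
exists (block_mx s%:M (s^-1 *: b) 0 L).
rewrite tr_block_mx mulmx_block tr_scalar_mx !linearZ /= trmx0.
rewrite !mul0mx !mulmx0 !addr0 -LE -scalar_mxM -expr2 sqr_sqrtr ?ltW //.
rewrite mul_scalar_mx mul_mx_scalar !scalerA mulfV // mulVf // !scale1r.
by rewrite -scalemxAl scalerA -invfM -expr2 sqr_sqrtr ?ltW // addrC subrK.
Qed.

(** The trace is the sum of the values of the quadratic form S at the rows of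
    W. *)
Lemma posdefmx_congr_trace_gt0 (m n : nat) (S : 'M[R]_n) (W : 'M[R]_(m, n)) :
  posdefmx R n S -> W != 0 -> 0 < \tr (W *m S *m W^T).
Proof.
move=> [_ Spos] W0.
have rowE i : (W *m S *m W^T) i i = (row i W *m S *m (row i W)^T) 0 0.
  by rewrite tr_row -!row_mul colE mulmxA -colE !mxE.
have ge0 i : 0 <= (W *m S *m W^T) i i.
  rewrite rowE; have [->|/Spos/ltW //] := eqVneq (row i W) 0.
  by rewrite !mul0mx mxE.
have [i Wi0] : exists i, row i W != 0.
  apply/existsP; apply: contraNT W0 => /existsPn W0.
  by apply/eqP/row_matrixP => i; rewrite row0; apply/eqP; rewrite -[_ == _]negbK.
rewrite /mxtrace (bigD1 i) //=; apply: ltr_pwDl; last exact: sumr_ge0.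
by rewrite rowE Spos.
Qed.

Lemma posdefmx_mxinner_gt0 (n : nat) (S A D : 'M[R]_n) :
  posdefmx R n S -> posdefmx R n A -> D^T = D -> D != 0 ->
  0 < mxinner S (D *m A *m D).
Proof.
move=> Spd Apd Dtr D0; have := posdefmx_unit Apd.
have [L ->] := posdefmx_cholesky Apd.
rewrite unitmx_mul => /andP[_ Lu].
have LD0 : L *m D != 0.
  by apply: contraNneq D0 => LD0; rewrite -(mulKmx Lu D) LD0 mulmx0.
have := posdefmx_congr_trace_gt0 Spd LD0.
rewrite trmx_mul Dtr -[L *m D *m S *m _]mulmxA mxtrace_mulC.
by rewrite /mxinner !mulmxA.
Qed.

End PositiveDefinite.

Section ConvexInverse.

(** The matrix form of a (a^-1 - x)^2 = a^-1 - 2 x + a x^2; for invertible X,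
    it measures by how much Y |-> Y^-1 at A lies above its tangent at X^-1. *)
Lemma invmx_sub_square (R : comUnitRingType) (n : nat) (A X : 'M[R]_n) :
  A \in unitmx ->
  (invmx A - X) *m A *m (invmx A - X) = invmx A - X *+ 2 + X *m A *m X.
Proof.
move=> Au; rewrite mulmxBl mulVmx // mulmxBl mul1mx mulmxBr mulmxK //.
by rewrite opprB mulr2n opprD !addrA addrAC.
Qed.

(** Averaging [invmx_sub_square] at X = M^-1 over A and B: the quadratic terms
    X A X and X B X average to X M X = X. *)
Lemma conv_invmx_gap (R : comUnitRingType) (n : nat) (t : R) (A B : 'M[R]_n)
    (M := t *: A + (1 - t) *: B)
    (DA := invmx A - invmx M) (DB := invmx B - invmx M) :
  A \in unitmx -> B \in unitmx -> M \in unitmx ->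
  t *: invmx A + (1 - t) *: invmx B - invmx M =
  t *: (DA *m A *m DA) + (1 - t) *: (DB *m B *m DB).
Proof.
move=> Au Bu Mu; rewrite /DA /DB !invmx_sub_square //.
set X := invmx M; set TA := X *m A *m X; set TB := X *m B *m X.
have XMX : t *: TA + (1 - t) *: TB = X.
  have : X *m M *m X = X by rewrite mulVmx // mul1mx.
  by rewrite /M mulmxDr mulmxDl -!scalemxAr -!scalemxAl.
rewrite !scalerDr addrACA XMX addrACA -scalerDl.
by rewrite [t + _]addrC subrK scale1r mulr2n opprD !addrA subrK.
Qed.

Lemma mxinner_invmx_strict_conv (R : realType) (n : nat) (S A B : 'M[R]_n)
    (t : R) :
  posdefmx R n S -> posdefmx R n A -> posdefmx R n B -> A != B ->
  0 < t < 1 ->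
  mxinner S (invmx (t *: A + (1 - t) *: B)) <
  t * mxinner S (invmx A) + (1 - t) * mxinner S (invmx B).
Proof.
move=> Spd Apd Bpd AB /andP[t0 t1].
have Mpd : posdefmx R n (t *: A + (1 - t) *: B).
  by apply: posdefmx_conv; rewrite ?ltW.
have gap := conv_invmx_gap (posdefmx_unit Apd) (posdefmx_unit Bpd)
                           (posdefmx_unit Mpd).
set M := t *: A + (1 - t) *: B in Mpd gap *.
have Dtr C : posdefmx R n C -> (invmx C - invmx M)^T = invmx C - invmx M.
  by move=> Cpd; rewrite linearB /= !trmx_inv !posdefmx_tr.
have DA0 : invmx A - invmx M != 0.
  rewrite subr_eq0 (inj_eq (can_inj invmxK)) -subr_eq0 /M.
  rewrite -{1}[A]scale1r opprD addrA -scalerBl -scalerBr scaler_eq0.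
  by rewrite !subr_eq0 negb_or AB gt_eqF.
have gA := posdefmx_mxinner_gt0 Spd Apd (Dtr A Apd) DA0.
have gB : 0 <= mxinner S ((invmx B - invmx M) *m B *m (invmx B - invmx M)).
  have [->|DB0] := eqVneq (invmx B - invmx M) 0.
    by rewrite /mxinner mulmx0 mulmx0 mxtrace0.
  exact/ltW/posdefmx_mxinner_gt0/DB0/Dtr.
set PA := _ *m A *m _ in gA gap; set PB := _ *m B *m _ in gB gap.
have := congr1 (mxinner S) gap; rewrite /mxinner in gA gB *.
rewrite mulmxBr !mulmxDr -!scalemxAr linearB !linearD !linearZ /= => gapS.
rewrite -subr_gt0 gapS; apply: ltr_pwDl; first exact: mulr_gt0.
by rewrite mulr_ge0 // subr_ge0 ltW.
Qed.

End ConvexInverse.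

Section SteinLoss.
Variables (R : realType) (n : nat).

Lemma stein_loss_strictly_convex (S : 'M[R]_n) : posdefmx R n S ->
  strictly_convex_function (E := 'M[R]_n) (posdefmx R n)
    (fun Sigma => symmetrized_stein_loss Sigma S).
Proof.
move=> Spd; split=> [A B t|t t0 t1 A B].
  rewrite !inE => Apd Bpd; apply: posdefmx_conv => //.
  by rewrite ge0 le1.
rewrite !inE => Apd Bpd AB; rewrite convRE /symmetrized_stein_loss.
have t01 : 0 < t%:num < 1 by rewrite t0.
have lt := mxinner_invmx_strict_conv Spd Apd Bpd AB t01.
have -> : mxinner (A <| t |> B) (invmx S) =
    t%:num * mxinner A (invmx S) + (1 - t%:num) * mxinner B (invmx S).
  by rewrite /mxinner mulmxDl -!scalemxAl linearD !linearZ.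
rewrite [A <| t |> B]/(t%:num *: A + (1 - t%:num) *: B).
rewrite !mulrBr addrACA -opprD -mulrDl.
rewrite [t%:num + _]addrC subrK mul1r ltrD2r.
rewrite !(mulrCA _ 2^-1) -mulrDr ltr_pM2l ?invr_gt0 ?ltr0n //.
by rewrite !mulrDr addrACA ltrD2r.
Qed.

Lemma symmetrized_stein_loss_invmx (K S : 'M[R]_n) :
  symmetrized_stein_loss (invmx K) S = symmetrized_stein_loss K (invmx S).
Proof.
rewrite /symmetrized_stein_loss /mxinner !invmxK.
by rewrite [X in _ * X]addrC; congr (_ * (_ + _) - _); exact: mxtrace_mulC.
Qed.

End SteinLoss.

Theorem proposition2p1 (R : realType) (n : nat) (S : 'M[R]_n)
    (S_pd : posdefmx R n S) :
  strictly_convex_function (E := 'M[R]_n) (posdefmx R n)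
    (fun Sigma => symmetrized_stein_loss Sigma S) /\
  strictly_convex_function (E := 'M[R]_n) (posdefmx R n)
    (fun K => symmetrized_stein_loss (invmx K) S).
Proof.
split; first exact: stein_loss_strictly_convex.
under [X in strictly_convex_function _ X]eq_fun do
  rewrite symmetrized_stein_loss_invmx.
exact/stein_loss_strictly_convex/posdefmx_inv.
Qed.
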